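(* For any positive odd integer $n$ and any integer $j$ with $0\le j\le n-1$, $$\sum_{k=0}^{n-j-1}q^{-k(k+1+j)}\begin{bmatrix}2k+j\\k\end{bmatrix}\equiv(-1)^j\left(\frac{n-j}{3}\right)q^{(n-j-1)(n-j-2)/6}\pmod{\Phi_n(q)}.$$
   Context: $q$ is an indeterminate. $\Phi_n(q)=\prod_{1\le k\le n,\ \gcd(n,k)=1}(q-\zeta^k)$, with $\zeta$ a primitive $n$-th root of unity, is the $n$-th cyclotomic polynomial. The $q$-shifted factorial is $(a;q)_0=1$, $(a;q)_n=(1-a)(1-aq)\cdots(1-aq^{n-1})$ for $n\ge 1$. The $q$-binomial coefficient is $\begin{bmatrix}n\\k\end{bmatrix}=\frac{(q;q)_n}{(q;q)_k(q;q)_{n-k}}$ if $0\le k\le n$, and $0$ otherwise. $\left(\frac{\cdot}{3}\right)$ denotes the Legendre symbol modulo $3$ (values $0,1,-1$ for arguments congruent to $0,1,2$ modulo $3$). A term whose Legendre symbol is $0$ is read as $0$ (the exponent of $q$ is an integer whenever the symbol is nonzero). A congruence $A(q)\equiv B(q)$ modulo $\Phi_n(q)$ means that $\Phi_n(q)$ divides $A(q)-B(q)$ in $\mathbb{Z}[q,q^{-1}]$. *)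

(* Defs.v *)
From HB Require Import structures.
From mathcomp Require Import all_boot all_order all_algebra all_field.

Set Implicit Arguments.
Unset Strict Implicit.
Unset Printing Implicit Defensive.

Import Order.TTheory GRing.Theory Num.Theory.
Local Open Scope ring_scope.

(* Rational functions Q(q), as the fraction field of Z[q]; the ring Z[q, q^-1] *)
(* is the subset cut out by [laurent] below.                                   *)
Notation ratfun := {fraction {poly int}}.

Definition polyF (p : {poly int}) : ratfun := FracField.tofrac p.

Definition q : ratfun := polyF 'X.

Definition qpoch (F : fieldType) (a x : F) (n : nat) : F :=
  \prod_(i < n) (1 - a * x ^+ i).

Definition qbinom (F : fieldType) (x : F) (n k : nat) : F :=
  if (k <= n)%N then qpoch x x n / (qpoch x x k * qpoch x x (n - k)) else 0.

Definition legendre3 (m : nat) : int :=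
  match (m %% 3)%N with
  | 0 => 0
  | 1 => 1
  | _ => -1
  end.

Definition laurent (f : ratfun) : Prop :=
  exists (p : {poly int}) (m : nat), f = polyF p / q ^+ m.

Definition laurent_eqmod (P A B : ratfun) : Prop :=
  exists2 g : ratfun, laurent g & A - B = P * g.

(* Main.v *)
Require Import Defs.
From mathcomp Require Import all_boot all_order all_algebra all_field.
From mathcomp Require Import ring zify.

Import GRing.Theory.
Local Open Scope ring_scope.

(** The [q]-binomials become Gaussian polynomials [gauss], which make sense at
any point of any commutative ring, so that the congruence modulo [Phi_n] turns
into an equality at a primitive [n]-th root of unity [z] ([Cyclotomic_dvd]).

Put [N = n - j - 1].  At [z] the factors of the numerator of the [q]-binomial
[2k+j] over [k] can be reflected, [1 - z^a = - z^a (1 - z^(n-a))], which gives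
([gauss_reflect])
  [gauss z (2k+j) k = (-1)^k z^(k(k+1+j)) z^C(k,2) gauss z (N-k) k].
The weight [z^(-k(k+1+j))] is the one that cancels the first power of [z], so
the left-hand side becomes the alternating sum
  [a_N = sum_k (-1)^k x^C(k,2) gauss x (N-k) k]
at [x = z].  This sum has a closed form for every nonzero [x] of any field.
Introducing a weight [y^k] ([alt_diag x y N]), the two Pascal rules give two
recurrences in [N] that shift [y] by [x] in opposite directions; eliminating
the shifted sums at [y = 1] leaves
  [a_(N+4) + x^(N+2) a_(N+1) = a_(N+3) + x^(N+1) a_N],
so [a_(N+3) + x^(N+1) a_N] does not depend on [N], and it vanishes at [N = 0].
Hence [a_(N+3) = - x^(N+1) a_N] ([alt_diag_step]); with [a_0 = a_1 = 1] and
[a_2 = 0], this is where the Legendre symbol modulo 3 and the exponent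
[N(N-1)/6] come from ([alt_diag1]).  As [n] is odd, the sign
[(-1)^N] is [(-1)^j]. *)

(** * Gaussian polynomials *)

Fixpoint gauss (R : comNzRingType) (x : R) (n k : nat) : R :=
  match n, k with
  | _, 0 => 1
  | 0, _.+1 => 0
  | n'.+1, k'.+1 => gauss R x n' k' + x ^+ k * gauss R x n' k
  end.
Arguments gauss {R} x n k : simpl never.

Lemma gauss0r (R : comNzRingType) (x : R) n : gauss x n 0 = 1.
Proof. by case: n. Qed.

Lemma gauss_small (R : comNzRingType) (x : R) n k :
  (n < k)%N -> gauss x n k = 0.
Proof.
elim: n k => [|n IHn] [|k] // ltnk.
by rewrite /gauss -/gauss !IHn ?mulr0 ?addr0 // ltnW.
Qed.

Lemma gaussS (R : comNzRingType) (x : R) n k :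
  gauss x n.+1 k.+1 = gauss x n k + x ^+ k.+1 * gauss x n k.+1.
Proof. by []. Qed.

(** Passing from [k] to [k+1] multiplies the numerator of the [q]-binomial by
[1 - x^(n-k)] and its denominator by [1 - x^(k+1)].  The identity is proved from the recursion rather than from the
quotient formula, so that it also holds when the denominators vanish. *)
Lemma gauss_absorb (R : comNzRingType) (x : R) n k :
  (1 - x ^+ k.+1) * gauss x n k.+1 = (1 - x ^+ (n - k)) * gauss x n k.
Proof.
elim: n k => [|n IHn] [|k].
- by rewrite gauss0r gauss_small // expr0; ring.
- by rewrite !gauss_small // !mulr0.
- have := IHn 0; rewrite gaussS !gauss0r !subn0 !mulr1 => E.
  by rewrite mulrDr mulrCA E (exprS x n); ring.
case: (leqP k.+1 n) => [lekn|ltnk]; last first.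
  have -> : (n.+1 - k.+1 = 0)%N by lia.
  by rewrite gauss_small ?expr0 ?ltnS //; ring.
have E1 := IHn k; have E2 := IHn k.+1.
rewrite !gaussS subSS.
have Dk : (n - k = (n - k.+1).+1)%N by lia.
have Dn : x ^+ (n - k) = x * x ^+ (n - k.+1) by rewrite Dk exprS.
rewrite Dn in E1 *.
move: E1 E2; rewrite !(exprS x k.+1); move: (x ^+ (n - k.+1)) => u.
move: (x ^+ k.+1) (gauss x n k) (gauss x n k.+1) (gauss x n k.+2) => v a b c.
move=> E1 E2; rewrite mulrDr mulrCA E2 [RHS]mulrDr -E1.
by ring.
Qed.

(** The Pascal rule complementary to the defining one; the difference
of the two is the absorption identity. *)
Lemma gaussS_top (R : comNzRingType) (x : R) n k :
  gauss x n.+1 k.+1 = gauss x n k.+1 + x ^+ (n - k) * gauss x n k.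
Proof.
have E := gauss_absorb R x n k.
rewrite gaussS; apply/eqP; rewrite -subr_eq0; apply/eqP.
transitivity ((1 - x ^+ (n - k)) * gauss x n k
              - (1 - x ^+ k.+1) * gauss x n k.+1); first by ring.
by rewrite E subrr.
Qed.

(** The quotient formula with the denominator cleared.  For [n < k] both sides
are zero, the right-hand one because of its factor at [i = n]. *)
Lemma qpoch_gauss (F : fieldType) (x : F) n k :
  qpoch x x k * gauss x n k = \prod_(i < k) (1 - x ^+ (n - i)).
Proof.
elim: k => [|k IHk]; first by rewrite /qpoch !big_ord0 gauss0r mulr1.
rewrite /qpoch !big_ord_recr /= -IHk -exprS -mulrA gauss_absorb /qpoch.
by rewrite mulrCA mulrC.
Qed.

Lemma qpoch_neq0 (F : fieldType) (x : F) n :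
  (forall i, (0 < i <= n)%N -> x ^+ i != 1) -> qpoch x x n != 0.
Proof.
move=> x1; apply/prodf_neq0 => i _.
by rewrite -exprS subr_eq0 eq_sym x1 //=.
Qed.

Lemma qbinom_gauss (F : fieldType) (x : F) n k :
  (forall i, (0 < i <= n)%N -> x ^+ i != 1) -> qbinom x n k = gauss x n k.
Proof.
move=> x1; rewrite /qbinom; case: leqP => [lekn|]; last by move/gauss_small->.
have nz m : (m <= n)%N -> qpoch x x m != 0.
  by move=> lemn; apply: qpoch_neq0 => i /andP[i0 im]; rewrite x1 ?i0 ?(leq_trans im).
suff -> : qpoch x x n = gauss x n k * (qpoch x x k * qpoch x x (n - k)).
  by rewrite mulfK // mulf_neq0 ?nz ?leq_subr.
rewrite mulrA [gauss _ _ _ * _]mulrC qpoch_gauss.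
elim: k lekn => [|k IHk] ltkn; first by rewrite big_ord0 mul1r subn0.
rewrite IHk 1?ltnW // big_ord_recr /= -mulrA; congr (_ * _).
have -> : (n - k = (n - k.+1).+1)%N by lia.
by rewrite /qpoch big_ord_recr /= -exprS mulrC.
Qed.

Lemma rmorph_gauss (R S : comNzRingType) (f : {rmorphism R -> S}) (x : R) n k :
  f (gauss x n k) = gauss (f x) n k.
Proof.
elim: n k => [|n IHn] [|k]; rewrite ?gauss0r ?rmorph1 //.
  by rewrite !gauss_small ?rmorph0.
by rewrite !gaussS rmorphD rmorphM rmorphXn !IHn.
Qed.

(** * An alternating sum along a diagonal of the q-Pascal triangle *)

Definition alt_diag {R : comNzRingType} (x y : R) (N : nat) : R :=
  \sum_(0 <= k < N.+1) (-1) ^+ k * x ^+ 'C(k, 2) * y ^+ k * gauss x (N - k) k.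

(** The terms of positive index are rewritten so that either Pascal rule applies
to the Gaussian polynomial in them. *)
Lemma alt_diag_expand (R : comNzRingType) (x y : R) N :
  alt_diag x y N.+2 =
  1 - \sum_(0 <= k < N.+1) (-1) ^+ k * x ^+ 'C(k, 2) * x ^+ k * y ^+ k.+1
        * gauss x (N - k).+1 k.+1.
Proof.
rewrite /alt_diag big_nat_recl // gauss0r bin0n !expr0 !mulr1; congr (_ + _).
rewrite big_nat_recr //= gauss_small ?mulr0 ?addr0; last by lia.
rewrite -sumrN; apply: eq_big_nat => k /andP[_ ltk].
rewrite binS bin1 subSS subSn; last by lia.
by rewrite exprD (exprS (-1) k); ring.
Qed.

(** The same expansion one step lower, with the summation range of
[alt_diag_expand], so that the two sums can be compared term by term. *)
Lemma alt_diag_expand1 (R : comNzRingType) (x y : R) N :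
  alt_diag x y N.+1 =
  1 - \sum_(0 <= k < N.+1) (-1) ^+ k * x ^+ 'C(k, 2) * x ^+ k * y ^+ k.+1
        * gauss x (N - k) k.+1.
Proof.
rewrite /alt_diag big_nat_recl // gauss0r bin0n !expr0 !mulr1; congr (_ + _).
rewrite -sumrN; apply: eq_big_nat => k /andP[_ ltk].
by rewrite binS bin1 subSS exprD (exprS (-1) k); ring.
Qed.

(** From the defining Pascal rule, whose factor [x^(k+1)] is absorbed by the
weight, turning [y] into [x * y]. *)
Lemma alt_diag_rec (R : comNzRingType) (x y : R) N :
  alt_diag x y N.+2 = alt_diag x (x * y) N.+1 - y * alt_diag x (x * y) N.
Proof.
rewrite alt_diag_expand alt_diag_expand1 -addrA -opprD; congr (1 - _).
rewrite /alt_diag mulr_sumr -big_split /=.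
apply: eq_bigr => k _; rewrite gaussS !exprMn (exprS y k).
by ring.
Qed.

(** From the complementary Pascal rule.  The recurrence naturally involves the weight divided by [x]; writing the weight as [x * y] keeps it valid
in every commutative ring. *)
Lemma alt_diag_rec_top (R : comNzRingType) (x y : R) N :
  alt_diag x (x * y) N.+2 =
  alt_diag x (x * y) N.+1 - y * x ^+ N.+1 * alt_diag x y N.
Proof.
rewrite alt_diag_expand alt_diag_expand1 -addrA -opprD; congr (1 - _).
rewrite /alt_diag mulr_sumr -big_split /=.
apply: eq_bigr => k _; rewrite gaussS_top !exprMn.
case: (leqP k (N - k)) => [lek|ltk]; last first.
  by rewrite (gauss_small _ _ _ _ ltk); ring.
have -> : x ^+ N.+1 = x * (x ^+ k * x ^+ k * x ^+ (N - k - k)).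
  by rewrite -!exprD -exprS; congr (x ^+ _); lia.
by rewrite (exprS x k) (exprS y k); ring.
Qed.

(** Three-step recurrence without shift of the weight.  Both recurrences are
used at [y = x^-1], where they relate sums of weight [1] to one sum of weight
[x^-1], which is then eliminated. *)
Lemma alt_diag_step (F : fieldType) (x : F) N :
  x != 0 -> alt_diag x 1 N.+3 = - x ^+ N.+1 * alt_diag x 1 N.
Proof.
move=> x0; apply/eqP; rewrite mulNr -addr_eq0; apply/eqP.
(* The quantity now claimed to be zero is independent of N. *)
elim: N => [|N IHN].
  rewrite /alt_diag unlock /= ?subSS ?subn0 !(gaussS, gauss0r).
  by rewrite !gauss_small // (@bin_small 0) // (@bin_small 1) //; ring.
have E1 := alt_diag_rec_top _ x x^-1 N.+2.
have E2 := alt_diag_rec _ x x^-1 N.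
rewrite mulfV // in E1 E2.
rewrite E1 E2 -[RHS]IHN (exprS _ N.+2) (exprS _ N.+1); field.
exact: x0.
Qed.

Lemma legendre3D3 m : legendre3 m.+3 = legendre3 m.
Proof. by rewrite /legendre3 -addn3 modnDr. Qed.

(** The exponent increases by exactly [N + 1] from [N] to [N + 3], since
[(N+3)(N+2) = N(N-1) + 6(N+1)]; the quotient is thus compatible with
[alt_diag_step] even when it is not exact. *)
Lemma alt_diag1 (F : fieldType) (x : F) N : x != 0 ->
  alt_diag x 1 N =
  (-1) ^+ N * (legendre3 N.+1)%:~R * x ^+ ((N * (N - 1)) %/ 6).
Proof.
move=> x0; elim/ltn_ind: N => -[|[|[|N]]] IHN.
- by rewrite /alt_diag unlock /= gauss0r bin_small // /legendre3 /= expr0; ring.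
- rewrite /alt_diag unlock /= gauss0r gauss_small //.
  by rewrite (@bin_small 0) // (@bin_small 1) // /legendre3 /= div0n expr0; ring.
- rewrite /alt_diag unlock /= ?subSS ?subn0 !(gaussS, gauss0r).
  rewrite !gauss_small // (@bin_small 0) // (@bin_small 1) //.
  by rewrite /legendre3 /= divn_small // expr0; ring.
rewrite alt_diag_step // IHN; last by lia.
have -> : (N.+3 * (N.+3 - 1) = N.+1 * 6 + N * (N - 1))%N by nia.
rewrite divnMDl // exprD legendre3D3 !(exprS (-1)); ring.
Qed.

(** * Evaluation at a primitive root of unity *)

Lemma prod_opp_geometric (R : comNzRingType) (z : R) m k :
  \prod_(i < k) - z ^+ (m + i) = (-1) ^+ k * z ^+ (k * m) * z ^+ 'C(k, 2).
Proof.
elim: k => [|k IHk]; first by rewrite big_ord0 bin_small // !expr0 !mulr1.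
rewrite big_ord_recr /= IHk binS bin1 mulSn !exprD (exprS (-1)); ring.
Qed.

(** Since [z^n = 1], replacing [1 - z^a] by [- z^a (1 - z^(n-a))] turns the
numerator for [2k+j] into the one for [n-j-1-k], and the denominators agree. *)
Lemma gauss_reflect (F : fieldType) (z : F) n j k :
  n.-primitive_root z -> (k + j < n)%N ->
  gauss z (2 * k + j) k =
  (-1) ^+ k * z ^+ (k * (k + 1 + j)) * z ^+ 'C(k, 2) * gauss z (n - j - 1 - k) k.
Proof.
move=> zP ltn.
have nz : qpoch z z k != 0.
  apply: qpoch_neq0 => i /andP[i0 ik]; rewrite -(prim_order_dvd zP).
  by apply/negP => /dvdn_leq; lia.
apply: (mulfI nz); rewrite [RHS]mulrCA !qpoch_gauss.
have zn := prim_expr_order zP.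
case: (leqP k (n - j - 1 - k)) => [le2k|lt2k]; last first.
  (* Here both numerators contain a vanishing factor, 1 - z^n on the left and
     1 - z^0 on the right. *)
  have lti : (n - j - 1 - k < k)%N by [].
  have lti' : (2 * k + j - n < k)%N by lia.
  rewrite (bigD1 (Ordinal lti')) //= [in RHS](bigD1 (Ordinal lti)) //= subnn expr0 subrr.
  have -> : (2 * k + j - (2 * k + j - n) = n)%N by lia.
  by rewrite zn subrr !mul0r mulr0.
rewrite -prod_opp_geometric -big_split (reindex_inj rev_ord_inj) /=.
apply: eq_bigr => -[i ltik] _ /=.
have -> : (2 * k + j - (k - i.+1) = k + 1 + j + i)%N by lia.
rewrite mulrBr mulr1 mulNr -exprD.
have -> : (k + 1 + j + i + (n - j - 1 - k - i) = n)%N by lia.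
by rewrite zn opprK addrC.
Qed.

Lemma gauss_sum_prim_root (F : fieldType) (z : F) n j :
  odd n -> (j < n)%N -> n.-primitive_root z ->
  \sum_(0 <= k < (n - j - 1).+1) z ^- (k * (k + 1 + j)) * gauss z (2 * k + j) k
  = (-1) ^+ j * (legendre3 (n - j))%:~R
      * z ^+ (((n - j - 1) * (n - j - 2)) %/ 6).
Proof.
move=> oddn ltjn zP.
have z0 : z != 0 by rewrite (prim_root_eq0 zP); lia.
transitivity (alt_diag z 1 (n - j - 1)).
  apply: eq_big_nat => k /andP[_ ltk].
  rewrite (gauss_reflect _ _ _ _ _ zP); last by lia.
  by rewrite expr1n; field; rewrite expf_neq0.
rewrite alt_diag1 //.
have -> : (n - j - 1).+1 = (n - j)%N by lia.
have -> : (n - j - 1 - 1 = n - j - 2)%N by lia.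
have -> : (-1) ^+ (n - j - 1) = (-1) ^+ j :> F; last by [].
by rewrite -signr_odd -[in RHS]signr_odd; congr (_ ^+ nat_of_bool _); lia.
Qed.

(** * From roots of unity to the congruence *)

(** ['Phi_n] is monic, hence division with remainder is possible over the
integers, and it is the minimal polynomial of [z] over the rationals, hence the
remainder, which has smaller degree and vanishes at [z], is zero. *)
Lemma Cyclotomic_dvd n (z : algC) (p : {poly int}) :
  n.-primitive_root z -> root (map_poly intr p) z ->
  exists r : {poly int}, p = 'Phi_n * r.
Proof.
move=> zP pz; have mon := Cyclotomic_monic n.
exists (Pdiv.Ring.rdivp p 'Phi_n).
rewrite {1}(Pdiv.RingMonic.rdivp_eq mon p) mulrC.
set r := Pdiv.Ring.rmodp _ _; suff -> : r = 0 by rewrite addr0.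
have rz : root (map_poly (intr : int -> algC) r) z.
  move: pz; rewrite /root {1}(Pdiv.RingMonic.rdivp_eq mon p) rmorphD rmorphM /=.
  rewrite hornerD hornerM (Cintr_Cyclotomic zP).
  have /rootP-> : root (cyclotomic z n) z by rewrite root_cyclotomic.
  by rewrite mulr0 add0r.
have [m [minE _] mP] := minCpolyP z.
set rQ : {poly rat} := map_poly intr r.
have rQE : map_poly ratr rQ = map_poly (intr : int -> algC) r.
  by rewrite -map_poly_comp; apply: eq_map_poly => i /=; rewrite ratr_int.
have szr : size rQ = size r.
  by apply: size_map_inj_poly; [exact: intr_inj | exact: mulr0z].
move: rz; rewrite -rQE mP => /dvdp_leq.
rewrite -size_poly_eq0 szr size_poly_eq0.
case: (eqVneq r 0) => // _ /(_ isT).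
have szm : size m = size ('Phi_n).
  rewrite -(size_map_poly (ratr : {rmorphism rat -> algC})) -minE.
  by rewrite (minCpoly_cyclotomic zP) size_cyclotomic size_Cyclotomic.
rewrite szm leqNgt => /negP[].
by apply: Pdiv.Ring.ltn_rmodpN0; rewrite monic_neq0.
Qed.

(** The difference of the two sides of the congruence, multiplied by the power
of [q] occurring in the denominator of its last term. *)
Definition cleared_defect (n j : nat) : {poly int} :=
  let M := ((n - j - 1) * (n - j - 1 + 1 + j))%N in
  \sum_(0 <= k < (n - j - 1).+1)
      'X^(M - k * (k + 1 + j)) * gauss 'X (2 * k + j) k
  - ((-1) ^+ j * (legendre3 (n - j))%:~R)
      * 'X^(M + ((n - j - 1) * (n - j - 2)) %/ 6).

(** Applied twice: to evaluation at a root of unity, and to the embedding of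
polynomials into rational functions. *)
Lemma rmorph_cleared_defect (F : fieldType) (f : {rmorphism {poly int} -> F})
    n j (x := f 'X) :
  x != 0 ->
  f (cleared_defect n j) =
  (\sum_(0 <= k < (n - j - 1).+1) x ^- (k * (k + 1 + j)) * gauss x (2 * k + j) k
   - (-1) ^+ j * (legendre3 (n - j))%:~R
      * x ^+ (((n - j - 1) * (n - j - 2)) %/ 6))
  * x ^+ ((n - j - 1) * (n - j - 1 + 1 + j)).
Proof.
move=> x0; rewrite /cleared_defect rmorphB rmorph_sum !rmorphM !rmorphXn.
rewrite rmorphN1 rmorph_int -/x mulrBl mulr_suml; congr (_ - _); last first.
  by rewrite exprD; ring.
apply: eq_big_nat => k /andP[_ ltk].
rewrite rmorphM rmorphXn rmorph_gauss -/x.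
have leM : (k * (k + 1 + j) <= (n - j - 1) * (n - j - 1 + 1 + j))%N.
  by rewrite leq_mul //; lia.
rewrite -{2}(subnK leM) exprD.
by field; rewrite expf_neq0.
Qed.

Theorem theorem3p1 (n j : nat) (hn0 : (0 < n)%N) (hn : odd n)
    (hj : (j <= n - 1)%N) :
  laurent_eqmod (polyF 'Phi_n)
    (\sum_(0 <= k < (n - j - 1).+1)
        q ^- (k * (k + 1 + j)) * qbinom q (2 * k + j) k)
    ((-1) ^+ j * (legendre3 (n - j))%:~R
        * q ^+ (((n - j - 1) * (n - j - 2)) %/ 6)).
Proof.
have [z zP] := C_prim_root_exists hn0.
have z0 : z != 0 by rewrite (prim_root_eq0 zP) -lt0n.
have Dz : root (map_poly intr (cleared_defect n j)) z.
  have cz : commr_rmorph (intr : int -> algC) z by move=> x; exact: mulrC.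
  pose ev : {rmorphism {poly int} -> algC} := horner_morph cz.
  have evX : ev 'X = z by exact: horner_morphX.
  rewrite /root -[_.[z]]/(ev (cleared_defect n j)).
  rewrite rmorph_cleared_defect evX // gauss_sum_prim_root //; last by lia.
  by rewrite subrr mul0r.
have [r DE] := Cyclotomic_dvd _ _ _ zP Dz.
have q0 : q != 0 by rewrite /q /polyF tofrac_eq0 polyX_eq0.
have q1 i : (0 < i)%N -> q ^+ i != 1.
  move=> i0; rewrite /q /polyF -rmorphXn -tofrac1 tofrac_eq.
  apply/eqP => /(congr1 (fun p : {poly int} => p`_i)).
  by rewrite coefXn coef1 eqxx; case: i i0.
pose M := ((n - j - 1) * (n - j - 1 + 1 + j))%N.
exists (polyF r / q ^+ M); first by exists r, M.
rewrite mulrA /polyF -rmorphM -DE rmorph_cleared_defect //.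
rewrite -/(polyF 'X) -/q mulfK ?expf_neq0 //; congr (_ - _).
apply: eq_bigr => k _; congr (_ * _); apply: qbinom_gauss.
move=> i /andP[i0 _]; exact: q1.
Qed.
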